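(* For any integers $1 \leq k \leq n$, we have the equality of ideals $J_{n,k} = \mathbf{T}(X_{n,k})$ in $\mathbb{Q}[x_1,\dots,x_n]$. Consequently, there is an isomorphism of ungraded $\mathfrak{S}_n$-modules $\mathbb{Q}[\mathcal{W}_{n,k}] \cong S_{n,k}$.
   Context: The symmetric group $\mathfrak{S}_n$ acts on $\mathbb{Q}[x_1,\dots,x_n]$ by variable permutation, $w \cdot x_i = x_{w(i)}$. Let $e_d = e_d(x_1,\dots,x_n)$ be the degree $d$ elementary symmetric polynomial and let $e_d^{(i)} = e_d(x_1,\dots,x_{i-1},x_{i+1},\dots,x_n)$ be the one with the variable $x_i$ omitted. Conventions: the degree $0$ elementary symmetric polynomial is $1$, and $e_d = e_d^{(i)} = 0$ for $d<0$. Define the ideals \[ J_n = \langle x_i^d \cdot e_{n-r}^{(i)} : 1 \leq i \leq n,\ 1 \leq r \leq d \rangle, \qquad J_{n,k} = J_n + \langle e_n, e_{n-1}, \ldots, e_{n-k+1}\rangle \] of $\mathbb{Q}[x_1,\dots,x_n]$ (here $d$ ranges over positive integers), and the quotient ring $S_{n,k} = \mathbb{Q}[x_1,\dots,x_n]/J_{n,k}$. A word $w = w_1 \cdots w_n$ over the positive integers is packed if for all $i>0$, whenever $i+1$ appears as a letter in $w$, so does $i$. Let $\mathcal{W}_{n,k}$ be the set of length $n$ packed words in which all of the letters $1,2,\dots,k$ appear. The group $\mathfrak{S}_n$ acts on $\mathcal{W}_{n,k}$ by permuting letter positions: $\sigma \cdot (w_1 \cdots w_n) = w_{\sigma^{-1}(1)}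 \cdots w_{\sigma^{-1}(n)}$; $\mathbb{Q}[\mathcal{W}_{n,k}]$ is the corresponding permutation module. Fix $n$ distinct rational numbers $\alpha_1,\dots,\alpha_n$. Let \[ X_{n,k} = \{(\alpha_{w_1},\dots,\alpha_{w_n}) : w_1\cdots w_n \in \mathcal{W}_{n,k}\} \subseteq \mathbb{Q}^n . \] For a finite set $X \subseteq \mathbb{Q}^n$, let $\mathbf{I}(X) = \{f \in \mathbb{Q}[x_1,\dots,x_n] : f(\mathbf{x}) = 0 \text{ for all } \mathbf{x} \in X\}$ and $\mathbf{T}(X) = \langle \tau(f) : f \in \mathbf{I}(X) \setminus \{0\}\rangle$, where $\tau(f)$ is the highest degree homogeneous component of the nonzero polynomial $f$. *)

(* Defs.v *)
From HB Require Import structures.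
From mathcomp Require Import all_boot all_order all_fingroup all_algebra.
From mathcomp Require Import generic_quotient ring_quotient.
From mathcomp Require Import boolp classical_sets.
From mathcomp.multinomials Require Import mpoly.

Set Implicit Arguments.
Unset Strict Implicit.
Unset Printing Implicit Defensive.

Import Order.TTheory GRing.Theory Num.Theory.

Local Open Scope classical_set_scope.
Local Open Scope ring_scope.
Local Open Scope quotient_scope.

(* The variables x_1, ..., x_n are 'X_i for i : 'I_n, so x_(i+1) is 'X_i.
   The library's msym s is the algebra morphism sending 'X_i to 'X_(s i). *)

Section Ideals.
Variable n : nat.
Implicit Types (p q : {mpoly rat[n]}) (G I : set {mpoly rat[n]}).

Definition ideal_gen G : set {mpoly rat[n]} :=
  [set p | exists m (c g : 'I_m -> {mpoly rat[n]}),
     (forall i, G (g i)) /\ p = \sum_(i < m) c i * g i].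

Definition ideal_add I1 I2 : set {mpoly rat[n]} :=
  [set p | exists p1 p2, [/\ I1 p1, I2 p2 & p = p1 + p2]].

Definition vanishing_ideal (X : set ('I_n -> rat)) : set {mpoly rat[n]} :=
  [set p | forall v, X v -> p.@[v] = 0].

(* Only meaningful for p != 0: msize p is then 1 + the total degree of p. *)
Definition top_component p : {mpoly rat[n]} :=
  pihomog mdeg (msize p).-1 p.

Definition top_ideal (X : set ('I_n -> rat)) : set {mpoly rat[n]} :=
  ideal_gen [set top_component p | p in
               [set p | vanishing_ideal X p /\ p != 0]].

Definition esym (d : int) : {mpoly rat[n]} :=
  if d is Posz m then mesym n rat m else 0.

Definition esym_omit (i : 'I_n) (d : int) : {mpoly rat[n]} :=
  if d is Posz m then
    \sum_(h : {set 'I_n} | (#|h| == m) && (i \notin h)) \prod_(j in h) 'X_j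
  else 0.

(* r may exceed n, hence the integer (not truncated) subtraction. *)
Definition gensJ : set {mpoly rat[n]} :=
  [set p | exists (i : 'I_n) (d r : nat), (1 <= r <= d)%N /\
             p = 'X_i ^+ d * esym_omit i (n%:Z - r%:Z)].

Definition gensE (k : nat) : set {mpoly rat[n]} :=
  [set p | exists j : nat, (j < k)%N /\ p = esym (n%:Z - j%:Z)].

Definition J : set {mpoly rat[n]} := ideal_gen gensJ.

Definition Jk (k : nat) : set {mpoly rat[n]} :=
  ideal_add J (ideal_gen (gensE k)).

End Ideals.

Section IdealTheory.
Variable n : nat.
Implicit Types (p q : {mpoly rat[n]}) (G I : set {mpoly rat[n]}).

Lemma ideal_gen0 G : ideal_gen G 0.
Proof.
exists 0%N, (fun=> 0), (fun=> 0); split; first by case.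
by rewrite big_ord0.
Qed.

Lemma ideal_genD G p q : ideal_gen G p -> ideal_gen G q -> ideal_gen G (p + q).
Proof.
move=> [m1 [c1 [g1 [Gg1 ->]]]] [m2 [c2 [g2 [Gg2 ->]]]].
pose glue (f1 : 'I_m1 -> {mpoly rat[n]}) (f2 : 'I_m2 -> {mpoly rat[n]})
  (i : 'I_(m1 + m2)) := match fintype.split i with inl j => f1 j | inr j => f2 j end.
exists (m1 + m2)%N, (glue c1 c2), (glue g1 g2); split.
  by move=> i; rewrite /glue; case: fintype.split.
rewrite big_split_ord /=; congr (_ + _); apply: eq_bigr => i _; rewrite /glue.
  by rewrite (unsplitK (inl i)).
by rewrite (unsplitK (inr i)).
Qed.

Lemma ideal_genM G a p : ideal_gen G p -> ideal_gen G (a * p).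
Proof.
move=> [m [c [g [Gg ->]]]]; exists m, (fun i => a * c i), g; split => //.
by rewrite mulr_sumr; apply: eq_bigr => i _; rewrite mulrA.
Qed.

Lemma ideal_gen_morph (f : {rmorphism {mpoly rat[n]} -> {mpoly rat[n]}}) G p :
  (forall g, G g -> G (f g)) -> ideal_gen G p -> ideal_gen G (f p).
Proof.
move=> fG [m [c [g [Gg ->]]]]; exists m, (f \o c), (f \o g); split.
  by move=> i /=; apply: fG.
by rewrite rmorph_sum; apply: eq_bigr => i _; rewrite rmorphM.
Qed.

Lemma Jk0 k : Jk k (0 : {mpoly rat[n]}).
Proof. by exists 0, 0; split; rewrite ?addr0 //; apply: ideal_gen0. Qed.

Lemma JkD k p q : Jk k p -> Jk k q -> Jk k (p + q).
Proof.
move=> [p1 [p2 [? ? ->]]] [q1 [q2 [? ? ->]]].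
by exists (p1 + q1), (p2 + q2); split; rewrite 1?addrACA //; apply: ideal_genD.
Qed.

Lemma JkM k a p : Jk k p -> Jk k (a * p).
Proof.
move=> [p1 [p2 [? ? ->]]]; exists (a * p1), (a * p2).
by split; rewrite 1?mulrDr //; apply: ideal_genM.
Qed.

Lemma gensJ_eval0 p : gensJ p -> p.@[fun=> 0] = 0.
Proof.
move=> [i [d [r [/andP[r1 rd] ->]]]].
by rewrite mevalM rmorphXn /= mevalXU expr0n eqn0Ngt (leq_trans r1 rd) mul0r.
Qed.

Lemma gensE_eval0 k p : (k <= n)%N -> gensE k p -> p.@[fun=> 0] = 0.
Proof.
move=> kn [j [jk ->]]; have jn := leq_trans jk kn.
rewrite subzn ?(ltnW jn) //= /mesym raddf_sum big1 //= => h /eqP hc.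
have /card_gt0P[i ih] : (0 < #|h|)%N by rewrite hc subn_gt0.
by rewrite (bigD1 i ih) /= mevalM mevalXU mul0r.
Qed.

Lemma ideal_gen_eval0 G v p : (forall g, G g -> g.@[v] = 0) ->
  ideal_gen G p -> p.@[v] = 0.
Proof.
move=> G0 [m [c [g [Gg ->]]]]; rewrite raddf_sum big1 //= => i _.
by rewrite mevalM (G0 _ (Gg i)) mulr0.
Qed.

Lemma Jk_proper k : (k <= n)%N -> ~ Jk k (1 : {mpoly rat[n]}).
Proof.
move=> kn [p1 [p2 [J1 J2 e]]].
have := congr1 (meval (fun=> 0)) e; rewrite meval1 mevalD.
rewrite (ideal_gen_eval0 gensJ_eval0 J1).
rewrite (ideal_gen_eval0 (fun g => @gensE_eval0 k g kn) J2) addr0.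
by move/eqP; rewrite oner_eq0.
Qed.

Lemma msymXU (s : 'S_n) i : msym s 'X_i = 'X_(s i) :> {mpoly rat[n]}.
Proof. by rewrite /msym mmapX mmap1U. Qed.

Lemma msym_esym_omit (s : 'S_n) i d :
  msym s (esym_omit i d) = esym_omit (s i) d.
Proof.
case: d => m /=; last by rewrite raddf0.
rewrite raddf_sum [RHS](reindex_inj (imset_inj (@perm_inj _ s))) /=.
apply: eq_big => [h|h _].
  by rewrite card_imset ?(mem_imset _ _ (@perm_inj _ s)) //; exact: perm_inj.
rewrite rmorph_prod big_imset /=; last by move=> ? ? _ _; apply: perm_inj.
by apply: eq_bigr => j _; rewrite msymXU.
Qed.

Lemma msym_Jk (s : 'S_n) k p : Jk k p -> Jk k (msym s p).
Proof.
move=> [p1 [p2 [J1 J2 ->]]]; exists (msym s p1), (msym s p2).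
split; last by rewrite raddfD.
  apply: ideal_gen_morph J1 => g [i [d [r [rd ->]]]]; exists (s i), d, r.
  by rewrite rmorphM rmorphXn /= msymXU msym_esym_omit.
apply: ideal_gen_morph J2 => g [j [jk ->]]; exists j; split => //.
case: (_ - _) => m /=; last by rewrite raddf0.
by have /issymP := @mesym_sym n rat m; apply.
Qed.

End IdealTheory.

(* The membership predicate of Jk; kn makes the ideal proper, as the library's
   quotient rings require. *)
Definition Jk_pred n k (kn : (k <= n)%N) : {pred {mpoly rat[n]}} :=
  fun p => `[< Jk k p >].

Section SQuotient.
Variables (n k : nat) (kn : (k <= n)%N).

Lemma Jk_idealr_closed : idealr_closed (Jk_pred kn).
Proof.
split.
- by apply/asboolP/Jk0.
- by apply/asboolP/Jk_proper.
- move=> a p q /asboolP Jp /asboolP Jq.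
  by apply/asboolP/JkD => //; apply: JkM.
Qed.

HB.instance Definition _ :=
  isIdealr.Build {mpoly rat[n]} (Jk_pred kn) Jk_idealr_closed.

Definition Snk := {ideal_quot (Jk_pred kn)}.

HB.instance Definition _ := GRing.ComNzRing.on Snk.
HB.instance Definition _ := EqQuotient.on Snk.

Lemma Snk_eqP (p q : {mpoly rat[n]}) :
  \pi_Snk p = \pi_Snk q <-> Jk k (p - q).
Proof.
split=> [/eqP|Jpq]; first by rewrite -Quotient.idealrBE => /asboolP.
by apply/eqP; rewrite -Quotient.idealrBE; apply/asboolP.
Qed.

(* Q acts on the quotient ring through constant polynomials. *)
Definition Snk_scale (c : rat) (x : Snk) : Snk := \pi_Snk c%:MP * x.

Lemma Snk_scaleA a b x : Snk_scale a (Snk_scale b x) = Snk_scale (a * b) x.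
Proof. by rewrite /Snk_scale mulrA -rmorphM /= mpolyCM. Qed.

Lemma Snk_scale1 : left_id 1 Snk_scale.
Proof. by move=> x; rewrite /Snk_scale rmorph1 mul1r. Qed.

Lemma Snk_scaleDr : right_distributive Snk_scale +%R.
Proof. by move=> c x y; rewrite /Snk_scale mulrDr. Qed.

Lemma Snk_scaleDl x : {morph Snk_scale^~ x : a b / a + b}.
Proof. by move=> a b; rewrite /Snk_scale mpolyCD rmorphD mulrDl. Qed.

HB.instance Definition _ := GRing.Zmodule_isLmodule.Build rat Snk
  Snk_scaleA Snk_scale1 Snk_scaleDr Snk_scaleDl.

Definition Snk_act (s : 'S_n) (x : Snk) : Snk := \pi_Snk (msym s (repr x)).

Lemma Snk_act_pi s (p : {mpoly rat[n]}) :
  Snk_act s (\pi_Snk p) = \pi_Snk (msym s p).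
Proof.
apply/Snk_eqP; rewrite -raddfB; apply: msym_Jk.
by apply/Snk_eqP; rewrite reprK.
Qed.

End SQuotient.

Section Words.
Local Open Scope nat_scope.
Variables n k : nat.
Implicit Types w : n.-tuple nat.

Definition packed w : bool := all (fun a => (1 < a) ==> (a.-1 \in w)) w.

Lemma packedP w :
  reflect (forall i, 0 < i -> i.+1 \in w -> i \in w) (packed w).
Proof.
apply: (iffP allP) => [pw i i0 /pw /=|pw [|[|i]] //= /pw]; last exact.
by rewrite ltnS i0.
Qed.

Definition is_word w : bool :=
  [&& all (fun a => 0 < a) w, packed w & all (fun a => a \in w) (iota 1 k)].

Record word := Word { word_val :> n.-tuple nat; word_prop : is_word word_val }.

HB.instance Definition _ := [isSub for word_val].
HB.instance Definition _ := [Countable of word by <:].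

Lemma word_letter_gt0 (w : word) a : a \in (w : n.-tuple nat) -> 0 < a.
Proof. by case/and3P: (word_prop w) => /allP w0 _ _ /w0. Qed.

Lemma word_letter_le (w : word) a : a \in (w : n.-tuple nat) -> a <= n.
Proof.
move=> aw; case/and3P: (word_prop w) => _ /packedP pw _.
have down j : j < a -> a - j \in (w : n.-tuple nat).
  elim: j => [|j IHj] ja; first by rewrite subn0.
  apply: pw; first by rewrite subn_gt0.
  by rewrite subnSK ?(ltnW ja) // IHj ?(ltnW ja).
have sub : {subset iota 1 a <= (w : n.-tuple nat)}.
  move=> b; rewrite mem_iota add1n ltnS => /andP[b0 ba].
  by rewrite -(subKn ba) down // ltn_subrL b0 (leq_trans b0 ba).
by have := uniq_leq_size (iota_uniq 1 a) sub; rewrite size_iota size_tuple.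
Qed.

Definition word_code (w : word) : n.-tuple 'I_n.+1 := map_tuple inord w.
Definition word_decode (t : n.-tuple 'I_n.+1) : option word :=
  insub (map_tuple val t).

Lemma word_codeK : pcancel word_code word_decode.
Proof.
move=> w; rewrite /word_decode.
suff -> : map_tuple val (word_code w) = w by rewrite valK.
apply: eq_from_tnth => i; rewrite !tnth_map /= inordK // ltnS.
exact/word_letter_le/mem_tnth.
Qed.

HB.instance Definition _ : isFinite word := PCanIsFinite word_codeK.

Lemma word_index_proof (w : word) i : (tnth w i).-1 < n.
Proof.
have wi := mem_tnth i w.
by rewrite prednK ?(word_letter_le wi) // (word_letter_gt0 wi).
Qed.

(* The letter w_i, i.e. a number in 1, ..., n, as an index (counted from 0). *)
Definition word_index (w : word) i : 'I_n := Ordinal (word_index_proof w i).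

Definition perm_tuple (s : 'S_n) w : n.-tuple nat :=
  [tuple tnth w ((s^-1)%g i) | i < n].

Lemma perm_tuple_mem s w : perm_tuple s w =i w.
Proof.
move=> a; apply/tnthP/tnthP => [[i ->]|[i ->]].
  by exists ((s^-1)%g i); rewrite tnth_mktuple.
by exists (s i); rewrite tnth_mktuple permK.
Qed.

Lemma perm_tuple_is_word s (w : word) : is_word (perm_tuple s w).
Proof.
rewrite /is_word /packed !(eq_all_r (perm_tuple_mem s w)).
have -> : all (fun a => (1 < a) ==> (a.-1 \in perm_tuple s w)) w = packed w.
  by apply: eq_all => a; rewrite perm_tuple_mem.
rewrite (eq_all (perm_tuple_mem s w)); exact: word_prop.
Qed.

Definition word_act (s : 'S_n) (w : word) : word := Word (perm_tuple_is_word s w).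

End Words.

Definition Xnk n k (alpha : 'I_n -> rat) : set ('I_n -> rat) :=
  [set v | exists w : word n k, v = fun i => alpha (word_index w i)].

(* Q[W_{n,k}]: u : {ffun word n k -> rat} stands for the formal combination
   \sum_w u w *: w, so that s sends u to \sum_w u w *: (s . w). *)
Definition QW n k := {ffun word n k -> rat^o}.
HB.instance Definition _ n k := GRing.Lmodule.on (QW n k).

Definition QW_act n k (s : 'S_n) (u : QW n k) : QW n k :=
  [ffun w => u (word_act (s^-1)%g w)].

Lemma word_actK n k (s : 'S_n) : cancel (@word_act n k s) (word_act (s^-1)%g).
Proof.
move=> w; apply/val_inj/eq_from_tnth => i.
by rewrite /= !tnth_mktuple invgK permK.
Qed.

Lemma word_actVK n k (s : 'S_n) : cancel (@word_act n k (s^-1)%g) (word_act s).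
Proof. by move=> w; have := word_actK (s^-1)%g w; rewrite invgK. Qed.

Lemma QW_act_basis n k (s : 'S_n) (w : word n k) :
  QW_act s [ffun w' => (w' == w)%:R] = [ffun w' => (w' == word_act s w)%:R].
Proof.
apply/ffunP => w'; rewrite !ffunE; congr (nat_of_bool _)%:R.
by apply/eqP/eqP=> [<-|->]; rewrite ?word_actVK ?word_actK.
Qed.

(* Main.v *)
Require Import Defs.
From HB Require Import structures.
From mathcomp Require Import all_boot all_order all_fingroup all_algebra.
From mathcomp Require Import generic_quotient ring_quotient.
From mathcomp Require Import boolp classical_sets.
From mathcomp.multinomials Require Import mpoly.

Set Implicit Arguments.
Unset Strict Implicit.
Unset Printing Implicit Defensive.

Import GRing.Theory.
Local Open Scope ring_scope.

(** Write [X] for the set of points attached to the packed words. The proof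
    squeezes [J_{n,k}] between two bounds that turn out to agree.

    One inclusion is explicit: every generator of [J_{n,k}] is the top component
    of a polynomial vanishing on [X] ([gensE_lift], [gensJ_lift]). If a set of
    values [z] is known to occur among the coordinates of a point [v], then the
    product of the [T + v_i] is divisible by the product of the [T + z], so all
    the coefficients of the remainder vanish at [v]; the low ones are elementary
    symmetric polynomials up to terms of lower degree ([esymc_lift]). For
    [e_{n-j}] the known values are the [k] required letters. For
    [x_i^r e_{n-r}^{(i)}], either the letter [w_i] is one of the first [r], and
    the product of the [x_i - alpha_a] with [a] among those letters vanishes, or
    [w_i] is larger, and then, the word being packed, the first [r] letters all
    occur at places other than [i].

    The other bound is that at most [#|X|] homogeneous polynomials span modulo
    [J_{n,k}] ([spans_Jk]). It rests on the exact sequence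
    [Q[x]/(I : a) -> Q[x]/I -> Q[x]/(I + (a))] ([spans_mod_colon]). With
    [a = e_{n-k}] it reduces [J_{n,k}] to [J_{n,k+1}] and to the ideal generated
    by the [x_i^k] and [e_n, ..., e_{n-k+1}], because [x_i^k e_{n-k}] is the sum
    of two generators of [J_{n,k}]; on the side of words, those that avoid the
    letter [k+1] are exactly the surjective words on [k] letters
    ([card_word_ge]). The quotient by the second ideal is bounded by removing
    the variables one at a time, filtering by the powers of the variable removed
    ([spans_gensR]), which matches the count of words by their first letter
    ([card_covering]).

    Evaluation on [X] is onto the functions on [X], and the first part lets one
    trade an element of [J_{n,k}] for a polynomial of smaller degree with the
    same values ([Jk_reduce]). So the spanning family, evaluated on [X], spans
    [Q^X]; having at most [#|X|] members, it is then a basis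
    ([ev_basis_free]), and comparing top components shows both that it is free
    modulo [J_{n,k}] and that every [tau(f)], [f] vanishing on [X], lies in
    [J_{n,k}] ([top_ideal_Jk]).

    The isomorphism must be equivariant, while a homogeneous basis gives a
    normal form [nf] modulo [J_{n,k}] that need not be. Averaging [nf] over the
    symmetric group and evaluating on [X] yields an equivariant map [symev] that
    kills [J_{n,k}]; since [nf p] and [p] differ by an element of [J_{n,k}], the
    averaging changes the values only through lower degree, so [symev] is still
    onto and the isomorphism is its inverse on the quotient. *)

(** * Degrees, leading forms and ideals *)

Section Degrees.
Variable n : nat.
Implicit Types (p q : {mpoly rat[n]}) (I K : set {mpoly rat[n]}).

Lemma msize_sum_le (T : Type) (r : seq T) (P : pred T)
    (F : T -> {mpoly rat[n]}) d :
  (forall i, P i -> (msize (F i) <= d)%N) ->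
  (msize (\sum_(i <- r | P i) F i) <= d)%N.
Proof.
move=> Fd; apply: leq_trans (msize_sum _ _ _) _.
by elim/big_rec: _ => // i m Pi md; rewrite geq_max Fd.
Qed.

Lemma msizeD_leW p q d :
  (msize p <= d)%N -> (msize q <= d)%N -> (msize (p + q) <= d)%N.
Proof.
by move=> pd qd; apply: leq_trans (msizeD_le _ _) _; rewrite geq_max pd.
Qed.

Lemma msizeB_leW p q d :
  (msize p <= d)%N -> (msize q <= d)%N -> (msize (p - q) <= d)%N.
Proof. by move=> pd qd; apply: msizeD_leW => //; rewrite msizeN. Qed.

Lemma msizeM_leW p q d e :
  (msize p <= d.+1)%N -> (msize q <= e)%N -> (msize (p * q) <= d + e)%N.
Proof.
move=> pd qe.
have [->|p0] := eqVneq p 0; first by rewrite mul0r msize0.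
have [->|q0] := eqVneq q 0; first by rewrite mulr0 msize0.
rewrite msizeM // -subn1 leq_subLR addnA add1n.
exact: leq_add.
Qed.

Lemma dhomog_msize_le d p : p \is d.-homog -> (msize p <= d.+1)%N.
Proof.
move=> /dhomogP hp; rewrite msizeE big_seq.
by apply/bigmax_leqP_seq => m _ /hp ->.
Qed.

Lemma msize_pihomog_le d p : (msize (pihomog mdeg d p) <= d.+1)%N.
Proof. exact/dhomog_msize_le/pihomogP. Qed.

Lemma msize_sub_pihomog d p :
  (msize p <= d.+1)%N -> (msize (p - pihomog mdeg d p) <= d)%N.
Proof.
move=> pd; rewrite {1}(pihomog_partitionE pd) big_ord_recr /= addrK.
apply: msize_sum_le => i _; exact: leq_trans (msize_pihomog_le _ _) _.
Qed.

Lemma msize_msym (s : 'S_n) p : (msize (msym s p) <= msize p)%N.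
Proof.
rewrite [msize (msym s p)]msizeE big_seq; apply/bigmax_leqP_seq => m mp _.
have : [multinom m (s i) | i < n] \in msupp p.
  by rewrite mcoeff_msupp -mcoeff_sym -mcoeff_msupp.
have -> : mdeg m = mdeg [multinom m (s i) | i < n].
  rewrite !mdegE (reindex_inj (@perm_inj _ s)) /=.
  by under [RHS]eq_bigr do rewrite mnmE.
exact: msize_mdeg_lt.
Qed.

(** Unlike [top_component], this makes sense for [p = 0], so that it is stable
    under sums, where top components may cancel. *)
Definition leads (d : nat) p q : Prop :=
  p \is d.-homog /\ (msize (q - p) <= d)%N.

Lemma leads_refl d p : p \is d.-homog -> leads d p p.
Proof. by split=> //; rewrite subrr msize0. Qed.

Lemma leads_msize d p q : leads d p q -> (msize q <= d.+1)%N.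
Proof.
case=> hp hq; rewrite -(subrK p q); apply: msizeD_leW; first exact: leqW.
exact: dhomog_msize_le.
Qed.

Lemma leadsD d p q p' q' : leads d p q -> leads d p' q' -> leads d (p + p') (q + q').
Proof.
move=> [hp hq] [hp' hq']; split; first exact: dhomogD.
by rewrite opprD addrACA; apply: msizeD_leW.
Qed.

Lemma leadsM d e p q p' q' :
  leads d p q -> leads e p' q' -> leads (d + e) (p * p') (q * q').
Proof.
move=> l l'; have [hp hq] := l; have [hp' hq'] := l'.
split; first exact: dhomogM.
have -> : q * q' - p * p' = q * (q' - p') + p' * (q - p).
  by rewrite !mulrBr [p' * q]mulrC [p' * p]mulrC addrA subrK.
apply: msizeD_leW; first exact: msizeM_leW (leads_msize l) hq'.
by rewrite addnC; apply: msizeM_leW (dhomog_msize_le hp') hq.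
Qed.

Lemma leads_prod (T : Type) (r : seq T) p (F : T -> {mpoly rat[n]}) :
  (forall i, leads 1 p (F i)) -> leads (size r) (p ^+ size r) (\prod_(i <- r) F i).
Proof.
move=> lF; elim: r => [|i r IH]; first by rewrite big_nil; apply/leads_refl/dhomog1.
by rewrite big_cons exprS; apply: leadsM (lF i) IH.
Qed.

Lemma pihomogM d p q k : (msize p <= k)%N -> (msize q <= k)%N ->
  pihomog mdeg d (p * q) =
  \sum_(i < k) \sum_(j < k | (i + j == d)%N) pihomog mdeg i p * pihomog mdeg j q.
Proof.
move=> pk qk.
rewrite {1}(pihomog_partitionE pk) {1}(pihomog_partitionE qk) mulr_suml raddf_sum.
apply: eq_bigr => i _; rewrite mulr_sumr raddf_sum /= [RHS]big_mkcond /=.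
apply: eq_bigr => j _.
have hij := dhomogM (pihomogP mdeg i p) (pihomogP mdeg j q).
have [<-|ne] := eqVneq (i + j)%N d; first exact: pihomog_dE.
exact: pihomog_ne0 hij.
Qed.

Record is_ideal I : Prop := IsIdeal {
  ideal0 : I 0;
  idealD : forall p q, I p -> I q -> I (p + q);
  idealM : forall a p, I p -> I (a * p) }.

Lemma idealN I p : is_ideal I -> I p -> I (- p).
Proof. by move=> II Ip; rewrite -mulN1r; apply: idealM. Qed.

Lemma idealB I p q : is_ideal I -> I p -> I q -> I (p - q).
Proof. by move=> II Ip Iq; apply: idealD => //; apply: idealN. Qed.

Lemma idealZ I c p : is_ideal I -> I p -> I (c *: p).
Proof. by move=> II Ip; rewrite -mul_mpolyC; apply: idealM. Qed.

Lemma ideal_sum I (T : Type) (r : seq T) (P : pred T) F : is_ideal I ->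
  (forall i, P i -> I (F i)) -> I (\sum_(i <- r | P i) F i).
Proof.
by move=> II IF; apply: big_ind => // [|p q]; [exact: ideal0|exact: idealD].
Qed.

Lemma ideal_gen_ideal G : is_ideal (@ideal_gen n G).
Proof. by split; [exact: ideal_gen0|exact: ideal_genD|exact: ideal_genM]. Qed.

Lemma ideal_gen_in G g : G g -> @ideal_gen n G g.
Proof.
move=> Gg; exists 1%N, (fun=> 1), (fun=> g); split=> //.
by rewrite big_ord1 mul1r.
Qed.

Lemma ideal_gen_min I G p : is_ideal I -> (forall g, G g -> I g) ->
  @ideal_gen n G p -> I p.
Proof.
move=> II GI [m [c [g [Gg ->]]]]; apply: ideal_sum => // i _.
by apply: idealM => //; apply: GI.
Qed.

Lemma Jk_ideal k : is_ideal (@Jk n k).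
Proof. by split; [exact: Jk0|exact: JkD|exact: JkM]. Qed.

Lemma Jk_gensJ k p : gensJ p -> @Jk n k p.
Proof.
move=> gp; exists p, 0; split; [exact: ideal_gen_in|exact: ideal_gen0|].
by rewrite addr0.
Qed.

Lemma Jk_gensE k p : gensE k p -> @Jk n k p.
Proof.
move=> gp; exists 0, p; split; [exact: ideal_gen0|exact: ideal_gen_in|].
by rewrite add0r.
Qed.

Lemma Jk_min I k p : is_ideal I -> (forall g, gensJ g -> I g) ->
  (forall g, gensE k g -> I g) -> @Jk n k p -> I p.
Proof.
move=> II HJ HE [p1 [p2 [J1 J2 ->]]]; apply: idealD => //.
  exact: ideal_gen_min J1.
exact: ideal_gen_min J2.
Qed.

(** The tool for passing from generators to a whole ideal: a property of
    homogeneous polynomials that is stable under sums and under homogeneous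
    multiples holds for all the components of the members of an ideal as soon as
    it holds for those of its generators. *)
Lemma graded_ideal (K : nat -> set {mpoly rat[n]}) :
  (forall d, K d 0) -> (forall d p q, K d p -> K d q -> K d (p + q)) ->
  (forall d e a p, a \is d.-homog -> K e p -> K (d + e)%N (a * p)) ->
  is_ideal [set p | forall d, K d (pihomog mdeg d p)].
Proof.
move=> K0 KD KM; split=> [d|p q hp hq d|a p hp d] /=.
- by rewrite raddf0; apply: K0.
- by rewrite raddfD; apply: KD.
- rewrite (@pihomogM d a p (maxn (msize a) (msize p))) ?leq_maxl ?leq_maxr //.
  apply: big_ind => [|p1 p2|i _]; [exact: K0|exact: KD|].
  apply: big_ind => [|p1 p2|j /eqP <-]; [exact: K0|exact: KD|].
  by apply: KM; rewrite ?pihomogP.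
Qed.

End Degrees.

(** * Elementary symmetric polynomials of a list of variables *)

Section Esymc.
Variable n : nat.
Implicit Types (s : seq 'I_n) (A J : {set 'I_n}) (p q : {mpoly rat[n]}).

(** This is [e_{size s - j}] in the variables listed by [s]. Counting from the
    top degree suits the generators [e_n, ..., e_{n-k+1}] of [J_{n,k}], which
    become the coefficients of index less than [k], and it makes the recursion
    [esymc_consS] free of truncated subtraction. *)
Definition esymc s j : {mpoly rat[n]} :=
  (\prod_(i <- s) ('X + ('X_i : {mpoly rat[n]})%:P))`_j.

Lemma esymc_nil j : esymc [::] j = (j == 0)%:R.
Proof. by rewrite /esymc big_nil coef1. Qed.

Lemma esymc_cons0 i s : esymc (i :: s) 0 = 'X_i * esymc s 0.
Proof. by rewrite /esymc big_cons mulrDl coefD coefXM coefCM add0r. Qed.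

Lemma esymc_consS i s j :
  esymc (i :: s) j.+1 = esymc s j + 'X_i * esymc s j.+1.
Proof. by rewrite /esymc big_cons mulrDl coefD coefXM coefCM. Qed.

Lemma esymc_perm s t j : perm_eq s t -> esymc s j = esymc t j.
Proof. by move=> st; rewrite /esymc (perm_big _ st). Qed.

Lemma esymc_gt s j : (size s < j)%N -> esymc s j = 0.
Proof.
elim: s j => [|i s IH] [|j] //=; first by rewrite esymc_nil.
by rewrite ltnS => sj; rewrite esymc_consS !IH ?(leqW sj) // mulr0 addr0.
Qed.

Lemma esymc_size s : esymc s (size s) = 1.
Proof.
elim: s => [|i s IH] /=; first by rewrite esymc_nil.
by rewrite esymc_consS IH esymc_gt // mulr0 addr0.
Qed.

Lemma X_homog (i : 'I_n) : ('X_i : {mpoly rat[n]}) \is 1.-homog.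
Proof. by rewrite dhomogX /= mdeg1. Qed.

Lemma esymc_homog s j e : size s = (e + j)%N -> esymc s j \is e.-homog.
Proof.
elim: s j e => [|i s IH] [|j] [|e] //=.
- by rewrite esymc_nil => _; apply: dhomog1.
- rewrite addn0 => -[se]; rewrite esymc_cons0 -add1n; apply: dhomogM (X_homog _) _.
  by apply: IH; rewrite se addn0.
- rewrite add0n => -[sj]; rewrite -sj -[(size s).+1]/(size (i :: s)).
  by rewrite esymc_size dhomog1.
- rewrite addSnnS addnS => -[se]; rewrite esymc_consS; apply: dhomogD.
    by apply: IH; rewrite se addSnnS.
  by rewrite -add1n; apply: dhomogM (X_homog _) _; apply: IH; rewrite se addnS.
Qed.

Lemma coef_prod_setD A j :
  (\prod_(i in A) ('X + ('X_i : {mpoly rat[n]})%:P))`_j =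
  \sum_(J : {set 'I_n} | (J \subset A) && (#|J| + j == #|A|)%N) \prod_(i in J) 'X_i.
Proof.
rewrite big_mkcond /=.
rewrite (eq_bigr (fun i => (if i \in A then ('X_i : {mpoly rat[n]})%:P else 0)
     + (if i \in A then 'X else 1))); last first.
  by move=> i _; case: ifP; rewrite ?add0r // addrC.
rewrite bigA_distr coef_sum [RHS]big_mkcondr big_mkcond /=.
apply: eq_bigr => J _; have [JA|] := boolP (J \subset A); last first.
  case/subsetPn=> i iJ iA.
  by rewrite (bigD1 i) //= iJ (negPf iA) mul0r coef0.
have -> : \prod_i (if i \in J then if i \in A then ('X_i : {mpoly rat[n]})%:P else 0
      else if i \in A then 'X else 1) = (\prod_(i in J) 'X_i)%:P * 'X^#|A :\: J|.
  rewrite (bigID (mem J)) /= rmorph_prod; congr (_ * _).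
    by apply: eq_bigr => i iJ; rewrite iJ (fintype.subsetP JA).
  rewrite -prodr_const (bigID (mem A)) /= [X in _ * X]big1 ?mulr1; last first.
    by move=> i /andP[/negPf-> /negPf->].
  apply: eq_big => i; first by rewrite !inE.
  by move=> /andP[/negPf-> ->].
rewrite coefCM coefXn cardsDS // -(eqn_add2l #|J|) subnKC ?subset_leq_card //.
by case: eqP; rewrite ?mulr1 ?mulr0.
Qed.

Lemma esym_esymc j : (j <= n)%N -> @Defs.esym n (n%:Z - j%:Z) = esymc (enum 'I_n) j.
Proof.
move=> jn; rewrite subzn //= /esymc.
transitivity ((\prod_(i in finset.setTfor 'I_n)
    ('X + ('X_i : {mpoly rat[n]})%:P))`_j).
  rewrite coef_prod_setD; apply: eq_bigl => J.
  by rewrite finset.subsetT finset.cardsT card_ord -(eqn_add2r j) subnK.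
by rewrite big_enum /=; congr ((polyseq _)`_j); apply: eq_bigl => i; rewrite !inE.
Qed.

(** The exponent [r + 1] in [n - (r + 1)] is one more than the index because the
    list without [i] has only [n - 1] entries. When [r >= n] both sides vanish,
    the left one because its degree is negative. *)
Lemma esym_omit_esymc (i : 'I_n) r :
  esym_omit i (n%:Z - r.+1%:Z) = esymc (rem i (enum 'I_n)) r.
Proof.
have sz : size (rem i (enum 'I_n)) = n.-1.
  by rewrite size_rem ?mem_enum // size_enum_ord.
have n0 : (0 < n)%N by exact: leq_ltn_trans (ltn_ord i).
have [rn|nr] := leqP r.+1 n; last first.
  rewrite esymc_gt ?sz ?prednK // -opprB subzn; last exact: ltnW.
  by case: (r.+1 - n)%N (subn_gt0 n r.+1) => [|d]; rewrite ?nr.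
rewrite subzn //= /esymc.
have -> : \prod_(j <- rem i (enum 'I_n)) ('X + ('X_j : {mpoly rat[n]})%:P)
    = \prod_(j in [set~ i]) ('X + ('X_j)%:P).
  rewrite rem_filter ?enum_uniq // big_filter big_enum_cond /=.
  by apply: eq_bigl => j; rewrite !inE.
rewrite coef_prod_setD; apply: eq_bigl => J.
rewrite cardsC1 card_ord finset.subsetC finset.sub1set inE andbC; congr (_ && _).
by rewrite -(eqn_add2r r.+1) subnK // addnS -[RHS]eqSS prednK.
Qed.

Lemma meval_esymc_modp (s : seq 'I_n) (v : 'I_n -> rat) (Q : {poly rat}) j :
  (\sum_(m < (size s).+1) ('X^m %% Q)`_j *: esymc s m).@[v] =
  ((\prod_(i <- s) ('X + (v i)%:P)) %% Q)`_j.
Proof.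
have Pv m : (esymc s m).@[v] = (\prod_(i <- s) ('X + (v i)%:P))`_m.
  rewrite /esymc -coef_map /= rmorph_prod /=; congr ((polyseq _)`_m).
  by apply: eq_bigr => i _; rewrite rmorphD /= map_polyX map_polyC /= mevalXU.
set P := \prod_(i <- s) _ in Pv *.
have -> : P = \sum_(m < (size s).+1) P`_m *: 'X^m.
  rewrite -poly_def; apply/polyP => m; rewrite coef_poly ltnS.
  by case: leqP => // sm; rewrite -Pv esymc_gt ?meval0.
rewrite raddf_sum (big_morph (fun R : {poly rat} => R %% Q) (modpD Q) (mod0p Q)).
by rewrite coef_sum; apply: eq_bigr => m _; rewrite /= mevalZ Pv modpZl coefZ mulrC.
Qed.

(** The lift comes from dividing the product of the [T + x_i], [i] in
    [s], by the product of the [T + z], [z] in [zs]: at a point whose coordinates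
    include every [z] the remainder is zero, and the coefficients of a remainder
    are linear combinations, with constant coefficients, of those of the
    dividend. Below degree [size zs] division changes nothing, so the [j]-th
    coefficient of the remainder is [esymc s j] plus multiples of the [esymc s m]
    with [m >= size zs], which have lower degree. *)
Lemma esymc_lift (s : seq 'I_n) (zs : seq rat) j e :
  uniq zs -> (j < size zs)%N -> size s = (e + j)%N ->
  exists2 q, leads e (esymc s j) q &
    forall v : 'I_n -> rat, (forall z, z \in zs -> exists2 i, i \in s & v i = z) ->
      q.@[v] = 0.
Proof.
move=> uz jz se; pose Q : {poly rat} := \prod_(z <- map -%R zs) ('X - z%:P).
have szQ : size Q = (size zs).+1 by rewrite size_prod_XsubC size_map.
have js : (j < (size s).+1)%N by rewrite ltnS se leq_addl.
exists (\sum_(m < (size s).+1) ('X^m %% Q)`_j *: esymc s m); last first.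
  move=> v vz; rewrite meval_esymc_modp modp_eq0 ?coef0 //.
  apply: uniq_roots_dvdp; last first.
    by rewrite uniq_rootsE map_inj_uniq //; apply: oppr_inj.
  apply/allP => _ /mapP[z /vz[i si vi] ->].
  rewrite rootE (big_rem i) //= hornerM hornerD hornerX hornerC vi addNr mul0r.
  exact: eqxx.
split; first exact: esymc_homog.
rewrite (bigD1 (Ordinal js)) //= modp_small ?size_polyXn ?szQ ?ltnS //.
rewrite coefXn eqxx scale1r /= [X in msize (X - _)]addrC addrK.
apply: msize_sum_le => -[m /= ms] /eqP mj.
have [mz|zm] := ltnP m (size zs).
  rewrite modp_small ?size_polyXn ?szQ ?ltnS // coefXn.
  case: eqP => [jm|_]; last by rewrite scale0r msize0.
  by case: mj; apply: val_inj.
apply: leq_trans (msizeZ_le _ _) _.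
have hm : esymc s m \is (size s - m).-homog by apply: esymc_homog; rewrite subnK.
apply: leq_trans (dhomog_msize_le hm) _.
by rewrite ltn_subLR // se addnC ltn_add2r (leq_trans jz).
Qed.

End Esymc.

(** * Homogeneous families spanning modulo an ideal *)

Section Spanning.
Variable n : nat.
Implicit Types (s : seq 'I_n) (p q : {mpoly rat[n]}) (I L : set {mpoly rat[n]}).

Definition spans_mod I N := exists b : 'I_N -> {mpoly rat[n]},
  (forall i, b i \is homog mdeg) /\
  (forall p, exists c : 'I_N -> rat, I (p - \sum_i c i *: b i)).

Definition adjoin I a : set {mpoly rat[n]} := [set p | exists q, I (p - a * q)].

Definition colon I a : set {mpoly rat[n]} := [set p | I (a * p)].

Lemma adjoin_ideal I a : is_ideal I -> is_ideal (adjoin I a).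
Proof.
move=> II; split.
- by exists 0; rewrite mulr0 subr0; apply: ideal0.
- move=> p p' [q Iq] [q' Iq']; exists (q + q').
  by rewrite mulrDr opprD addrACA; apply: idealD.
- move=> c p [q Iq]; exists (c * q).
  by rewrite mulrCA -mulrBr; apply: idealM.
Qed.

Lemma colon_ideal I a : is_ideal I -> is_ideal (colon I a).
Proof.
move=> II; split; rewrite /colon /=.
- by rewrite mulr0; apply: ideal0.
- by move=> p q Ip Iq; rewrite mulrDr; apply: idealD.
- by move=> c p Ip; rewrite mulrCA; apply: idealM.
Qed.

Lemma adjoin_sub I a p : I p -> adjoin I a p.
Proof. by exists 0; rewrite mulr0 subr0. Qed.

Lemma adjoin_gen I a q : is_ideal I -> adjoin I a (a * q).
Proof. by move=> II; exists q; rewrite subrr; apply: ideal0. Qed.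

Lemma spans_mod_sub I L N :
  (forall p, I p -> L p) -> spans_mod I N -> spans_mod L N.
Proof.
move=> IL [b [hb sb]]; exists b; split=> // p.
by have [c /IL] := sb p; exists c.
Qed.

Lemma spans_mod_unit I : is_ideal I -> I 1 -> spans_mod I 0.
Proof.
move=> II I1; exists (fun=> 0); split=> [[]//|p]; exists (fun=> 0).
by rewrite -[X in I X]mulr1; apply: idealM.
Qed.

(** A spanning family modulo [I + (a)] leaves a remainder [a * q] modulo [I],
    and it is enough to reduce [q] modulo [I : a]. Homogeneity of [a] keeps the
    combined family homogeneous. *)
Lemma spans_mod_colon I a N1 N2 : is_ideal I -> a \is homog mdeg ->
  spans_mod (adjoin I a) N1 -> spans_mod (colon I a) N2 -> spans_mod I (N1 + N2).
Proof.
move=> II /homogP[da ha] [b1 [hb1 sb1]] [b2 [hb2 sb2]].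
pose b i := match fintype.split i with inl j => b1 j | inr j => a * b2 j end.
exists b; split=> [i|p].
  rewrite /b; case: fintype.split => j //.
  by have /homogP[d hd] := hb2 j; apply: homogE (dhomogM ha hd).
have [c1 [q Iq]] := sb1 p; have [c2 Iq2] := sb2 q.
exists (fun i => match fintype.split i with inl j => c1 j | inr j => c2 j end).
have bl (j : 'I_N1) : fintype.split (lshift N2 j) = inl j := unsplitK (inl j).
have br (j : 'I_N2) : fintype.split (rshift N1 j) = inr j := unsplitK (inr j).
rewrite big_split_ord /= /b.
under eq_bigr do rewrite bl; under [X in _ - (_ + X)]eq_bigr do rewrite br.
have -> : \sum_i c2 i *: (a * b2 i) = a * \sum_i c2 i *: b2 i.
  by rewrite mulr_sumr; apply: eq_bigr => i _; rewrite scalerAr.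
rewrite opprD addrA -[X in X - _](subrK (a * q)) -addrA -mulrBr.
exact: idealD.
Qed.

(** The number of words of length [m] over [k] letters in which [r] prescribed
    letters all occur, sorted by their first letter: see [card_covering]. *)
Fixpoint cover_count k m r := match m with
  | 0 => nat_of_bool (r == 0%N)
  | m'.+1 => (r * cover_count k m' r.-1 + (k - r) * cover_count k m' r)%N
  end.

(** The variables outside [s] are generators too, so that the quotient is the
    polynomial ring in the variables of [s] modulo the powers [x_i^k] and the
    top [r] elementary symmetric polynomials; changing [s] then does not change
    the ambient ring. For [r = k] this is the generalized coinvariant ideal of
    Haglund, Rhoades and Shimozono. *)
Definition gensR s k r : set {mpoly rat[n]} :=
  [set p | [\/ exists2 i, i \in s & p = 'X_i ^+ k,
               exists2 i, i \notin s & p = 'X_i |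
               exists2 j, (j < r)%N & p = esymc s j]].

Lemma colon_pow I a d p : colon (colon I (a ^+ d)) a p <-> colon I (a ^+ d.+1) p.
Proof. by rewrite /colon /mkset exprSr -mulrA; split. Qed.

(** If [E] and [E'] are the products of the [T + x_l] over [i :: s] and over
    [s], then [E = (T + x_i) E']; solving for the coefficients of [E'] from the
    bottom up costs one power of [x_i] for each index. *)
Lemma ideal_esymc_pow I i s r d j : is_ideal I ->
  (forall j, (j < r)%N -> I (esymc (i :: s) j)) ->
  (j < r)%N -> (j < d)%N -> I ('X_i ^+ d * esymc s j).
Proof.
move=> II HI; elim: j d => [|j IH] [|d] // jr jd.
  by rewrite exprSr -mulrA -esymc_cons0; apply/(idealM II)/HI.
have -> : 'X_i ^+ d.+1 * esymc s j.+1 =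
    'X_i ^+ d * esymc (i :: s) j.+1 - 'X_i ^+ d * esymc s j.
  by rewrite esymc_consS -mulrBr addrC addKr exprSr mulrA.
apply: idealB => //; first exact/(idealM II)/HI.
by apply: IH; first exact: ltnW.
Qed.

(** The step that removes the variable [x_i]: modulo [x_i], the colon ideal by
    [x_i^d] contains the corresponding ideal for [s]. Setting [x_i = 0] turns
    [esymc (i :: s) j.+1] into [esymc s j], which loses one of the [r]
    generators; once [d >= r], all of them are recovered by
    [ideal_esymc_pow]. *)
Lemma gensR_step i s k r d p :
  (d < k)%N -> gensR s k (if (d < r)%N then r.-1 else r) p ->
  adjoin (colon (ideal_gen (gensR (i :: s) k r)) ('X_i ^+ d)) 'X_i p.
Proof.
set I := ideal_gen _ => dk.
have II : is_ideal I := ideal_gen_ideal _.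
have HE j : (j < r)%N -> I (esymc (i :: s) j).
  by move=> jr; apply: ideal_gen_in; apply: Or33; exists j.
case=> [[i' si' ->]|[i' si' ->]|[j jr ->]].
- apply: adjoin_sub; apply: idealM => //; apply: ideal_gen_in; apply: Or31.
  by exists i'; rewrite // inE si' orbT.
- have [->|ii'] := eqVneq i' i.
    by rewrite -[X in adjoin _ _ X]mulr1; apply/adjoin_gen/colon_ideal.
  apply: adjoin_sub; apply: idealM => //; apply: ideal_gen_in; apply: Or32.
  by exists i'; rewrite // inE negb_or ii' si'.
- case: ifP jr => [dr jr|dr jr]; last first.
    apply: adjoin_sub; apply: (ideal_esymc_pow II HE jr).
    by rewrite (leq_trans jr) // leqNgt dr.
  have jr' : (j.+1 < r)%N by case: (r) jr.
  exists (- esymc s j.+1); rewrite mulrN opprK -esymc_consS.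
  exact/(idealM II)/HE.
Qed.

(** Filtering by the powers [x_i^d], [d < k], gives [k] successive quotients,
    [r] of them of the type with [r - 1] symmetric generators and [k - r] of the
    type with [r]: the recursion defining [cover_count]. *)
Lemma spans_gensR s k r : (r <= k)%N ->
  spans_mod (ideal_gen (gensR s k r)) (cover_count k (size s) r).
Proof.
elim: s r => [|i s IH] r rk /=.
  have II r' : is_ideal (ideal_gen (gensR [::] k r')) := ideal_gen_ideal _.
  case: r rk => [|r] _ /=; last first.
    apply: spans_mod_unit => //; apply: ideal_gen_in; apply: Or33; exists 0%N => //.
    by rewrite esymc_nil.
  exists (fun=> 1); split=> [_|p]; first exact/homogP/(ex_intro _ 0%N)/dhomog1.
  exists (fun=> p@_0%MM); rewrite big_ord1.
  have I_X m : ideal_gen (gensR [::] k 0) ('X_[m] - (m == 0%MM)%:R *: 1).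
    have [->|m0] := eqVneq m 0%MM.
      by rewrite mpolyX0 scale1r subrr; apply: ideal0.
    have [i mi] : exists i, m i != 0%N.
      apply/existsP; apply: contraNT m0; rewrite negb_exists => /forallP m0.
      by apply/eqP/mnmP => i; rewrite mnm0E; apply/eqP; rewrite -[_ == _]negbK.
    rewrite scale0r subr0 -(@submK _ U_(i)%MM m) ?lep1mP // mpolyXD.
    by apply: idealM => //; apply: ideal_gen_in; apply: Or32; exists i.
  have -> : p - p@_0%MM *: 1 =
      \sum_(m <- msupp p) p@_m *: ('X_[m] - (m == 0%MM)%:R *: 1).
    under eq_bigr do rewrite scalerBr scalerA.
    rewrite sumrB -mpolyE -scaler_suml; congr (_ - _ *: _).
    rewrite {1}[p]mpolyE raddf_sum /=; apply: eq_bigr => m _.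
    by rewrite mcoeffZ mcoeffX.
  by apply: ideal_sum => // m _; apply: idealZ.
set I := ideal_gen _; set N := cover_count k (size s) in IH *.
have II : is_ideal I := ideal_gen_ideal _.
(* Descending induction on the power, from [x_i^k], which lies in [I], to [1]. *)
have filtration e : (e <= k)%N ->
    spans_mod (colon I ('X_i ^+ (k - e)))
      (\sum_(k - e <= d < k) if (d < r)%N then N r.-1 else N r).
  elim: e => [|e IHe] ek.
    rewrite subn0 big_geq //; apply: spans_mod_unit; first exact: colon_ideal.
    rewrite /colon /= mulr1; apply: ideal_gen_in; apply: Or31.
    by exists i; rewrite // inE eqxx.
  have dk : (k - e.+1 < k)%N by rewrite ltn_subrL (leq_trans _ ek).
  have := IHe (ltnW ek); rewrite -(subnSK ek) => {}IHe; rewrite big_ltn //.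
  apply: (@spans_mod_colon _ 'X_i).
  - exact: colon_ideal.
  - exact: homogE (X_homog i).
  - have rk' : ((if (k - e.+1 < r)%N then r.-1 else r) <= k)%N.
      by case: ifP => // _; apply: leq_trans (leq_pred _) rk.
    have := IH _ rk'; rewrite (fun_if N); apply: spans_mod_sub => p.
    apply: ideal_gen_min => [|g]; last exact: gensR_step.
    exact/adjoin_ideal/colon_ideal.
  - by apply: spans_mod_sub IHe => p; rewrite colon_pow.
have := filtration k (leqnn k); rewrite subnn expr0.
rewrite (big_cat_nat (leq0n r) rk) /=.
rewrite (eq_big_nat _ _ (F2 := fun=> N r.-1)) => [|d /andP[_ ->] //].
rewrite [X in (_ + X)%N](eq_big_nat _ _ (F2 := fun=> N r)); last first.
  move=> d /andP[rd _].
  by rewrite ltnNge rd.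
rewrite !sum_nat_const_nat subn0; apply: spans_mod_sub => p.
by rewrite /colon /mkset mul1r.
Qed.


End Spanning.

(** * A spanning family modulo J_{n,k} no larger than the set of words *)

Section SpanningJk.
Variable n : nat.

Lemma Jk_esymc k j : (k <= n)%N -> (j < k)%N -> Jk k (esymc (enum 'I_n) j).
Proof.
move=> kn jk; apply: Jk_gensE; exists j; split=> //.
by rewrite esym_esymc // (leq_trans (ltnW jk)).
Qed.

Lemma Jk_esymc_omit k (i : 'I_n) r :
  Jk k ('X_i ^+ r.+1 * esymc (rem i (enum 'I_n)) r).
Proof.
by apply: Jk_gensJ; exists i, r.+1, r.+1; rewrite esym_omit_esymc /= leqnn.
Qed.

(** Splitting [e_{n-k}] according to whether [x_i] occurs writes [x_i^k e_{n-k}]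
    as the sum of the generators of [J_n] with exponents [k] and [k + 1]. *)
Lemma Jk_pow_esymc k (i : 'I_n) : (0 < k)%N ->
  Jk k ('X_i ^+ k * esymc (enum 'I_n) k).
Proof.
case: k => // k _.
have in_i : i \in enum 'I_n by rewrite mem_enum.
rewrite (esymc_perm _ (perm_to_rem in_i)) esymc_consS mulrDr mulrA -exprSr.
by apply: JkD; apply: Jk_esymc_omit.
Qed.

(** Adding [e_{n-k}] to [J_{n,k}] gives [J_{n,k+1}], and by [Jk_pow_esymc] the
    annihilator of [e_{n-k}] contains a generalized coinvariant ideal. *)
Lemma spans_Jk_step k N : (0 < k)%N -> (k <= n)%N ->
  spans_mod (@Jk n k.+1) N -> spans_mod (@Jk n k) (N + cover_count k n k).
Proof.
move=> k0 kn sN; have IJ := Jk_ideal n k.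
have IA := adjoin_ideal (esymc (enum 'I_n) k) IJ.
have IC := colon_ideal (esymc (enum 'I_n) k) IJ.
apply: (spans_mod_colon (a := esymc (enum 'I_n) k)) => //.
- apply: (homogE (d := (n - k)%N)); apply: esymc_homog.
  by rewrite size_enum_ord subnK.
- apply: spans_mod_sub sN => p; apply: Jk_min => // g.
    by move=> Jg; apply/adjoin_sub/Jk_gensJ.
  case=> j [jk ->]; rewrite esym_esymc; last exact: leq_trans kn.
  have [->|jk'] := eqVneq j k.
    by rewrite -[X in adjoin _ _ X]mulr1; apply: adjoin_gen.
  by apply/adjoin_sub/Jk_esymc; rewrite // ltn_neqAle jk'.
- have := spans_gensR (enum 'I_n) (leqnn k); rewrite size_enum_ord.
  apply: spans_mod_sub => p; apply: ideal_gen_min => // g.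
  case=> [[i _ ->]|[i]|[j jk ->]].
  + by rewrite /colon /mkset mulrC; apply: Jk_pow_esymc.
  + by rewrite mem_enum.
  + by apply: idealM => //; apply: Jk_esymc.
Qed.

(** The descent on [k] starts at [n + 1], where [e_0 = 1] is a generator. *)
Lemma spans_Jk_top : spans_mod (@Jk n n.+1) 0.
Proof.
apply: spans_mod_unit; first exact: Jk_ideal.
apply: Jk_gensE; exists n; split=> //.
by rewrite esym_esymc // -[X in esymc _ X]size_enum_ord esymc_size.
Qed.

End SpanningJk.

Section Counting.

Lemma card_covering k m (A : {set 'I_k}) :
  #|[set t : m.-tuple 'I_k | [forall a in A, a \in t]]| = cover_count k m #|A|.
Proof.
elim: m A => [|m IH] A.
  have [->|[a aA]] := set_0Vmem A.
    rewrite cards0 /= -[RHS](card_tuple 0 'I_k); apply: eq_card => t.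
    by rewrite !inE; apply/forallP => a; rewrite inE.
  rewrite (cardsD1 a A) aA /=; apply: eq_card0 => t; rewrite inE tuple0.
  by apply/negbTE/forallPn; exists a; rewrite aA.
rewrite -sum1dep_card.
rewrite (reindex (fun p : 'I_k * m.-tuple 'I_k => cons_tuple p.1 p.2)) /=;
  last first.
  exists (fun t => (thead t, behead_tuple t)) => [[a t] _|t _] /=.
    by congr (_, _); apply: val_inj.
  by rewrite [RHS]tuple_eta; apply: val_inj.
transitivity (\sum_(a : 'I_k) cover_count k m #|A :\ a|).
  under [RHS]eq_bigr do rewrite -IH -sum1dep_card.
  rewrite pair_big_dep /=; apply: eq_bigl => -[a t] /=.
  apply/forallP/forallP => H b; apply/implyP.
    rewrite !inE => /andP[ba bA]; have := H b.
    by rewrite bA inE (negPf ba).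
  move=> bA; rewrite inE; have [//|ba] := eqVneq b a.
  by have := H b; rewrite !inE ba bA.
rewrite (bigID (mem A)) /=; congr (_ + _)%N.
  rewrite (eq_bigr (fun=> cover_count k m #|A|.-1)) ?sum_nat_const // => a aA.
  by rewrite (cardsD1 a A) aA.
rewrite (eq_bigr (fun=> cover_count k m #|A|)) => [|a aA].
  rewrite sum_nat_const; congr (_ * _)%N.
  have := cardC (mem A); rewrite card_ord => kA.
  by rewrite -[X in (X - _)%N]kA addKn; apply: eq_card => a; rewrite !inE.
congr (cover_count _ _ #|pred_of_set _|); apply/setP => b; rewrite !inE.
by case: eqVneq aA => // -> /negPf.
Qed.

(** A word containing [1, ..., k] either also contains [k + 1], or, being packed,
    uses the letters [1, ..., k] only; the latter are the surjective words. Only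
    the inequality is proved, by injecting each of the two kinds. *)
Lemma card_word_ge n k : (0 < k)%N ->
  (#|{: word n k.+1}| + cover_count k n k <= #|{: word n k}|)%N.
Proof.
move=> k0.
rewrite -(cardC (fun w : word n k => k.+1 \in (w : n.-tuple nat))).
apply: leq_add.
  have iotaSk : iota 1 k.+1 = iota 1 k ++ [:: k.+1] by rewrite -{1}(addn1 k) iotaD.
  have P (w : word n k.+1) : is_word k w.
    have := word_prop w; rewrite /is_word iotaSk all_cat.
    by case/and3P=> -> -> /andP[].
  have K (w : word n k.+1) : k.+1 \in (Word (P w) : n.-tuple nat).
    have := word_prop w; rewrite /is_word iotaSk all_cat /= andbT.
    by case/and3P=> _ _ /andP[].
  rewrite -(card_codom (f := fun w => Word (P w))); last first.
    by move=> w w' [] /val_inj.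
  by apply/subset_leq_card/fintype.subsetP => _ /codomP[w ->]; apply: K.
rewrite -[X in cover_count _ _ X](card_ord k) -cardsT -card_covering.
set S := [set _ | _].
have Sin t (a : 'I_k) : t \in S -> a \in t.
  by rewrite inE => /forallP /(_ a); rewrite inE.
have letter t b : t \in S -> (0 < b <= k)%N ->
    b \in map_tuple (fun a : 'I_k => a.+1) t.
  case: b => // b tS /= bk; apply/mapP; exists (Ordinal bk) => //; exact: Sin.
have P (t : {t : n.-tuple 'I_k | t \in S}) :
    is_word k (map_tuple (fun a : 'I_k => a.+1) (val t)).
  apply/and3P; split.
  - by apply/allP => _ /mapP[a _ ->].
  - apply/packedP => i i0 /mapP[a _ [ia]]; apply: letter (valP t) _.
    by rewrite i0 ia ltnW.
  - by apply/allP => b; rewrite mem_iota add1n ltnS => /(letter _ _ (valP t)).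
rewrite -card_sig -(card_codom (f := fun t => Word (P t))); last first.
  move=> t t' [] /inj_map tt'; apply/val_inj/val_inj/tt'.
  by move=> a b [] /val_inj.
apply/subset_leq_card/fintype.subsetP => _ /codomP[t ->].
rewrite !inE; apply/mapP => -[a _ [ka]].
by have := ltn_ord a; rewrite -ka ltnn.
Qed.

Lemma spans_Jk n k : (0 < k)%N -> (k <= n.+1)%N ->
  exists2 N, spans_mod (@Jk n k) N & (N <= #|{: word n k}|)%N.
Proof.
move=> k0 kn; rewrite -(subKn kn); have := leq_subr k n.+1.
have : (n.+1 - k < n.+1)%N by rewrite ltn_subrL k0.
elim: (n.+1 - k)%N => [|d IH] dn _.
  by exists 0%N; [rewrite subn0; apply: spans_Jk_top|].
have [N sN leN] := IH (ltnW dn) (leqW (ltnW dn)).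
rewrite -(subnSK (ltnW dn)) in sN leN.
exists (N + cover_count (n.+1 - d.+1) n (n.+1 - d.+1))%N.
  by apply: spans_Jk_step; rewrite ?subn_gt0 ?leq_subr // subSS leq_subr.
apply: leq_trans (card_word_ge _ _); last by rewrite subn_gt0.
by rewrite leq_add2r.
Qed.

End Counting.

(** * Lifting the generators to polynomials vanishing on the points *)

Section Lifting.
Variables (n k : nat) (kn : (k <= n)%N) (alpha : 'I_n -> rat).
Hypothesis alpha_inj : injective alpha.
Implicit Types (p q : {mpoly rat[n]}) (w : word n k).

Definition point w : 'I_n -> rat := fun i => alpha (word_index w i).

Lemma word_index_onto w a : a.+1 \in (w : n.-tuple nat) ->
  exists i, word_index w i = a :> nat.
Proof. by case/tnthP=> i wi; exists i; rewrite /= -wi. Qed.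

Lemma word_index_required w a : (a < k)%N -> exists i, word_index w i = a :> nat.
Proof.
move=> ak; apply: word_index_onto; have /and3P[_ _ /allP] := word_prop w.
by apply; rewrite mem_iota add1n ltnS.
Qed.

Lemma word_index_below w i a : (a < word_index w i)%N ->
  exists j, word_index w j = a :> nat.
Proof.
rewrite /= => ai; apply: word_index_onto.
have /and3P[_ /packedP pw _] := word_prop w.
have down d : (d < tnth w i)%N -> (tnth w i - d)%N \in (w : n.-tuple nat).
  elim: d => [|d IH] di; first by rewrite subn0 mem_tnth.
  apply: pw; first by rewrite subn_gt0.
  by rewrite subnSK ?(ltnW di) // IH ?(ltnW di).
have ai' : (a.+1 <= tnth w i)%N by apply: leq_trans ai (leq_pred _).
rewrite -(subKn ai') down // ltn_subrL /=.
exact: leq_trans ai'.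
Qed.

Definition vanishing q := forall w, q.@[point w] = 0.

Definition roots m (mn : (m <= n)%N) : seq rat :=
  [seq alpha (widen_ord mn a) | a <- enum 'I_m].

Lemma uniq_roots_alpha m (mn : (m <= n)%N) : uniq (roots mn).
Proof.
rewrite map_inj_uniq ?enum_uniq // => a b /alpha_inj/(congr1 val)/= ab.
exact: val_inj.
Qed.

Lemma size_roots m (mn : (m <= n)%N) : size (roots mn) = m.
Proof. by rewrite size_map size_enum_ord. Qed.

Lemma gensE_lift j : (j < k)%N ->
  exists2 q, leads (n - j) (esymc (enum 'I_n) j) q & vanishing q.
Proof.
move=> jk; have jn := leq_trans jk kn.
have [||q lq vq] := @esymc_lift n (enum 'I_n) _ j (n - j) (uniq_roots_alpha kn).
- by rewrite size_roots.
- by rewrite size_enum_ord subnK // ltnW.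
exists q => // w; apply: vq => _ /mapP[a _ ->].
have [i wi] := word_index_required w (ltn_ord a).
exists i; first by rewrite mem_enum.
by congr alpha; apply: val_inj.
Qed.

(** The lift is a product of two factors of which at least one vanishes at every
    point: the first when the letter at place [i] is among the first [r + 1],
    the second otherwise, because those letters then occur at other places. *)
Lemma gensJ_lift (i : 'I_n) r : (r < n)%N ->
  exists2 q, leads n ('X_i ^+ r.+1 * esymc (rem i (enum 'I_n)) r) q & vanishing q.
Proof.
move=> rn.
have sz : size (rem i (enum 'I_n)) = (n - r.+1 + r)%N.
  rewrite size_rem ?mem_enum // size_enum_ord.
  by rewrite -[RHS]/(_.+1.-1) -addnS subnK.
have [|q lq vq] := @esymc_lift n _ _ r _ (uniq_roots_alpha rn) _ sz.
  by rewrite size_roots.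
have lX c : leads 1 ('X_i) ('X_i - c%:MP).
  split; first exact: X_homog.
  by rewrite addrC addKr msizeN msizeC; case: eqP.
exists (\prod_(z <- roots rn) ('X_i - z%:MP) * q).
  have := leads_prod (roots rn) lX; rewrite size_roots => /leadsM /(_ lq).
  by rewrite subnKC.
move=> w; rewrite mevalM; have [wi|iw] := leqP (word_index w i) r.
  have in_roots : point w i \in roots rn.
    apply/mapP; exists (Ordinal (wi : (word_index w i < r.+1)%N)).
      by rewrite mem_enum.
    by congr alpha; apply: val_inj.
  rewrite (big_rem _ in_roots) /= !mevalM mevalB mevalXU mevalC subrr.
  by rewrite !mul0r.
rewrite vq ?mulr0 // => _ /mapP[a _ ->].
have [j wj] := word_index_below (leq_ltn_trans (leq_ord a) iw).
exists j; last by congr alpha; apply: val_inj.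
rewrite mem_rem_uniq ?enum_uniq // !inE mem_enum andbT.
apply: contraTneq iw => <-; rewrite wj -leqNgt; exact: leq_ord.
Qed.

(** Both conclusions, that the ideal is homogeneous and that its homogeneous
    elements lift, are checked on generators at once by [graded_ideal]. *)
Lemma Jk_graded_lift p : Jk k p -> forall d,
  Jk k (pihomog mdeg d p) /\ exists2 q, leads d (pihomog mdeg d p) q & vanishing q.
Proof.
pose K d : set {mpoly rat[n]} :=
  [set h | Jk k h /\ exists2 q, leads d h q & vanishing q]%classic.
have K0 d : K d 0.
  split; first exact: Jk0.
  by exists 0 => [|w]; [apply/leads_refl/rpred0|rewrite meval0].
have KD d h h' : K d h -> K d h' -> K d (h + h').
  move=> [Jh [q lq vq]] [Jh' [q' lq' vq']]; split; first exact: JkD.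
  exists (q + q') => [|w]; first exact: leadsD.
  by rewrite mevalD vq vq' addr0.
have KM d e a h : a \is d.-homog -> K e h -> K (d + e)%N (a * h).
  move=> ha [Jh [q lq vq]]; split; first exact: JkM.
  exists (a * q) => [|w]; first exact: leadsM (leads_refl ha) lq.
  by rewrite mevalM vq mulr0.
have KL e g : K e g -> forall d, K d (pihomog mdeg d g).
  move=> Kg d; have [_ [_ [hg _] _]] := Kg.
  have [<-|ed] := eqVneq e d; first by rewrite pihomog_dE.
  by rewrite (pihomog_ne0 ed hg); apply: K0.
apply: (Jk_min (I := [set p | forall d, K d (pihomog mdeg d p)]%classic)).
- exact: graded_ideal.
- move=> _ [i [d [[|r] [/andP[// r1 rd] ->]]]]; rewrite esym_omit_esymc.
  have [rn|nr] := ltnP r n; last first.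
    rewrite esymc_gt ?mulr0; first by apply: (KL 0%N); apply: K0.
    rewrite size_rem ?mem_enum // size_enum_ord.
    by apply: leq_trans nr; rewrite prednK // (leq_ltn_trans _ (ltn_ord i)).
  rewrite -(subnK rd) exprD -mulrA.
  apply: (KL ((d - r.+1) + n)%N); apply: KM.
    by have := dhomogMn (d - r.+1) (X_homog i); rewrite mul1n.
  by split; [apply: Jk_esymc_omit|apply: gensJ_lift].
- move=> _ [j [jk ->]]; rewrite esym_esymc ?(leq_trans (ltnW jk)) //.
  apply: (KL (n - j)%N); split; first exact: Jk_esymc.
  exact: gensE_lift.
Qed.

Lemma pihomog_small d p : (msize p <= d)%N -> pihomog mdeg d p = 0.
Proof.
move=> pd; rewrite (pihomog_partitionE pd) raddf_sum big1 // => i _.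
by apply: pihomog_ne0 (pihomogP _ _ _); rewrite ltn_eqF.
Qed.

Lemma leads_top d p q : leads d p q -> p != 0 -> q != 0 /\ top_component q = p.
Proof.
move=> lq p0; have [hp szqp] := lq.
have qp : pihomog mdeg d q = p.
  by rewrite -(subrK p q) raddfD /= pihomog_small // add0r pihomog_dE.
have szq : msize q = d.+1.
  apply/eqP; rewrite eqn_leq (leads_msize lq) ltnNge.
  by apply: contraNN p0 => /pihomog_small; rewrite qp => ->.
by split; [rewrite -msize_poly_eq0 szq|rewrite /top_component szq].
Qed.

Lemma Jk_top_ideal p : Jk k p -> top_ideal (Xnk k alpha) p.
Proof.
move=> Jp; rewrite (pihomog_partitionE (leqnn (msize p))).
have IT : is_ideal (top_ideal (Xnk k alpha)) := ideal_gen_ideal _.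
apply: ideal_sum => // d _; have [_ [q lq vq]] := Jk_graded_lift Jp d.
have [->|h0] := eqVneq (pihomog mdeg d p) 0; first exact: ideal0.
have [q0 <-] := leads_top lq h0.
apply: ideal_gen_in; exists q => //; split=> // _ [w ->]; exact: vq.
Qed.

(** Subtracting a lift of its top component lowers the degree of an element of
    [J_{n,k}] without changing its values on the points. *)
Lemma Jk_reduce d p : Jk k p -> (msize p <= d.+1)%N ->
  exists2 p', (msize p' <= d)%N & vanishing (p - p').
Proof.
move=> Jp pd; have [_ [q [_ lq] vq]] := Jk_graded_lift Jp d.
exists (p - q); last by rewrite subKr.
have -> : p - q = p - pihomog mdeg d p - (q - pihomog mdeg d p).
  by rewrite opprB addrA subrK.
by apply: msizeB_leW => //; apply: msize_sub_pihomog.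
Qed.

End Lifting.

(** * Evaluation on the points *)

Section Evaluation.
Variables (n k : nat) (alpha : 'I_n -> rat).
Implicit Types (p q : {mpoly rat[n]}) (w : word n k) (u : QW n k).

Definition ev p : QW n k := [ffun w => p.@[point alpha w]].

Lemma ev_is_linear : linear ev.
Proof. by move=> c p q; apply/ffunP => w; rewrite !ffunE mevalD mevalZ. Qed.

HB.instance Definition _ :=
  GRing.isLinear.Build rat {mpoly rat[n]} (QW n k) _ ev ev_is_linear.

Lemma ev_eq0 p : ev p = 0 <-> vanishing k alpha p.
Proof.
split=> [e w|e]; last by apply/ffunP => w; rewrite !ffunE e.
by have /ffunP/(_ w) := e; rewrite !ffunE.
Qed.

Lemma point_inj : injective alpha -> injective (@point n k alpha).
Proof.
move=> alpha_inj w w' e; apply/val_inj/eq_from_tnth => i.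
have := congr1 (fun v => v i) e => /alpha_inj/(congr1 val)/=.
have := word_letter_gt0 (mem_tnth i w); have := word_letter_gt0 (mem_tnth i w').
by case: (tnth w i) (tnth w' i) => [|a] [|a'] //= _ _ ->.
Qed.

Lemma ev_surj : injective alpha -> forall u, exists p, ev p = u.
Proof.
move=> /point_inj pt_inj u.
(* A sum of squares of rationals separates a point from all the others without
   choosing a coordinate in which they differ. *)
pose dist w' : {mpoly rat[n]} := \sum_i ('X_i - (point alpha w' i)%:MP) ^+ 2.
have distE w w' : (dist w').@[point alpha w] =
    \sum_i (point alpha w i - point alpha w' i) ^+ 2.
  rewrite raddf_sum /=; apply: eq_bigr => i _.
  by rewrite rmorphXn /= mevalB mevalXU mevalC.
have dist0 w w' : ((dist w').@[point alpha w] == 0) = (w == w').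
  rewrite distE; apply/eqP/eqP => [d0|->]; last first.
    by apply: big1 => i _; rewrite subrr expr0n.
  apply/pt_inj/funext => i; apply/eqP; rewrite -subr_eq0 -sqrf_eq0.
  apply/eqP; apply: (Num.Theory.psumr_eq0P (P := predT)) d0 i isT => i' _.
  exact: Num.Theory.sqr_ge0.
pose delta w := \prod_(w' | w' != w) dist w'.
have deltaE w w' : (delta w).@[point alpha w'] =
    (w' == w)%:R * (delta w).@[point alpha w].
  have [->|ww'] := eqVneq w' w; first by rewrite mul1r.
  rewrite mul0r /delta (bigD1 w') //= mevalM.
  by have /eqP-> : (dist w').@[point alpha w'] == 0; rewrite ?dist0 // mul0r.
have delta0 w : (delta w).@[point alpha w] != 0.
  rewrite rmorph_prod /=; apply/prodf_neq0 => w' w'w.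
  by rewrite dist0 eq_sym.
exists (\sum_w (u w / (delta w).@[point alpha w]) *: delta w).
apply/ffunP => w; rewrite ffunE raddf_sum (bigD1 w) //= big1 ?addr0 => [|w' w'w].
  by rewrite mevalZ divfK.
by rewrite mevalZ (deltaE w' w) [w == w']eq_sym (negPf w'w) mul0r mulr0.
Qed.

Lemma QW_act_is_linear (s : 'S_n) : linear (@QW_act n k s).
Proof. by move=> c u u'; apply/ffunP => w; rewrite !ffunE. Qed.

HB.instance Definition _ (s : 'S_n) :=
  GRing.isLinear.Build rat (QW n k) (QW n k) _ (@QW_act n k s) (QW_act_is_linear s).

Lemma ev_msym (s : 'S_n) p : ev (msym s p) = QW_act s (ev p).
Proof.
rewrite [p]mpolyE [msym s _]linear_sum !linear_sum /=; apply: eq_bigr => m _.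
rewrite !linearZ /= msymX; congr (_ *: _); apply/ffunP => w; rewrite !ffunE.
rewrite !mevalX (reindex_inj (@perm_inj _ s)) /=.
apply: eq_bigr => i _; rewrite mnmE permK; congr (alpha _ ^+ _).
by apply: val_inj; rewrite /= tnth_mktuple invgK.
Qed.

(** A spanning family with no more members than the dimension is a
    basis: the rank of the matrix of its values is the dimension, hence at least
    the number of its rows. *)
Lemma spanning_free N (f : 'I_N -> QW n k) : (N <= #|{: word n k}|)%N ->
  (forall u, exists c : 'I_N -> rat, u = \sum_i c i *: f i) ->
  forall c : 'I_N -> rat, \sum_i c i *: f i = 0 -> forall i, c i = 0.
Proof.
move=> leN span c c0.
pose M : 'M[rat]_(N, #|{: word n k}|) := \matrix_(i, j) f i (enum_val j).
have ME (c' : 'I_N -> rat) j :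
    ((\row_i c' i) *m M) 0 j = (\sum_i c' i *: f i) (enum_val j).
  rewrite mxE sum_ffunE; apply: eq_bigr => i _; rewrite !mxE.
  by rewrite ffunE.
have Mfull : row_full M.
  rewrite -sub1mx; apply/row_subP => j; apply/submxP.
  have [c' c'E] := span [ffun w => (w == enum_val j)%:R].
  exists (\row_i c' i); apply/rowP => j'.
  rewrite ME -c'E ffunE !mxE (inj_eq enum_val_inj) eq_sym.
  by [].
have Mfree : row_free M.
  by rewrite -row_leq_rank (eqP Mfull).
have := row_free_inj Mfree (x1 := \row_i c i) (x2 := 0 : 'rV_N).
rewrite mul0mx => /(_ _) e i.
have /rowP/(_ i) : \row_i c i = 0 :> 'rV_N.
  by apply: e; apply/rowP => j; rewrite ME c0 ffunE !mxE.
by rewrite !mxE.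
Qed.

End Evaluation.

(** * The spanning family is a basis, and the ideals agree *)

Section HomogeneousBasis.
Variables (n k : nat) (kn : (k <= n)%N) (alpha : 'I_n -> rat).
Hypothesis alpha_inj : injective alpha.
Variables (N : nat) (b : 'I_N -> {mpoly rat[n]}).
Hypothesis b_homog : forall i, b i \is homog mdeg.
Hypothesis b_span : forall p, exists c : 'I_N -> rat, Jk k (p - \sum_i c i *: b i).
Hypothesis leN : (N <= #|{: word n k}|)%N.
Implicit Types (p q : {mpoly rat[n]}) (u : QW n k) (c : 'I_N -> rat).

Local Notation ev := (@ev n k alpha).
Local Notation red := (Jk_reduce kn alpha_inj).

Lemma comb_msize d c : (forall i, (d < msize (b i))%N -> c i = 0) ->
  (msize (\sum_i c i *: b i) <= d)%N.
Proof.
move=> cd; apply: msize_sum_le => i _; have [di|id] := ltnP d (msize (b i)).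
  by rewrite cd // scale0r msize0.
exact: leq_trans (msizeZ_le _ _) id.
Qed.

Lemma ev_comb c : ev (\sum_i c i *: b i) = \sum_i c i *: ev (b i).
Proof. by rewrite linear_sum; apply: eq_bigr => i _; rewrite linearZ. Qed.

(** Homogeneity of the family and of the ideal allow discarding the members of
    degree higher than that of [p]. *)
Lemma bounded_span d p : (msize p <= d)%N ->
  exists2 c, Jk k (p - \sum_i c i *: b i) &
    forall i, (d < msize (b i))%N -> c i = 0.
Proof.
move=> pd; have [c Jc] := b_span p.
exists (fun i => if (d < msize (b i))%N then 0 else c i); last by move=> i ->.
have : Jk k (\sum_(e < d) pihomog mdeg e (p - \sum_i c i *: b i)).
  apply: ideal_sum (Jk_ideal n k) _ => e _.
  by have [] := Jk_graded_lift kn alpha_inj Jc e.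
congr (Jk _ _).
rewrite (eq_bigr (fun e : 'I_d =>
  pihomog mdeg e p - \sum_i pihomog mdeg e (c i *: b i))).
  rewrite sumrB -pihomog_partitionE // exchange_big /=; congr (_ - _).
  apply: eq_bigr => i _.
  under eq_bigr do rewrite linearZ /=.
  rewrite -scaler_sumr; case: ltnP => di; last by rewrite -pihomog_partitionE.
  rewrite scale0r big1 ?scaler0 // => e _.
  have hb := b_homog i; rewrite homog_msize in hb.
  apply: pihomog_ne0 hb; rewrite gtn_eqF // ltn_predRL.
  exact: leq_ltn_trans (ltn_ord e) di.
by move=> e _; rewrite raddfB; congr (_ - _); apply: linear_sum.
Qed.

(** Induction on the degree: the remainder modulo [J_{n,k}] has the same values
    as a polynomial of lower degree. *)
Lemma ev_bounded_span d p : (msize p <= d)%N ->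
  exists2 c, ev p = \sum_i c i *: ev (b i) &
    forall i, (d < msize (b i))%N -> c i = 0.
Proof.
elim: d p => [|d IH] p pd.
  exists (fun=> 0) => //; rewrite big1 => [|i _]; last by rewrite scale0r.
  by move: pd; rewrite leqn0 msize_poly_eq0 => /eqP->; rewrite linear0.
have [c Jc cd] := bounded_span pd.
have [|p' p'd vp'] := red (d := d) Jc.
  by apply: msizeB_leW => //; apply: comb_msize.
have [c' evp' c'd] := IH p' p'd.
exists (fun i => c i + c' i) => [|i di]; last by rewrite cd // c'd ?addr0 // ltnW.
under eq_bigr do rewrite scalerDl; rewrite big_split /= -evp'.
have /ev_eq0/eqP := vp'; rewrite !linearB /= ev_comb.
by rewrite subr_eq0 subr_eq addrC => /eqP.
Qed.

Lemma ev_basis_free c : \sum_i c i *: ev (b i) = 0 -> forall i, c i = 0.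
Proof.
apply: spanning_free => // u; have [p <-] := ev_surj alpha_inj u.
by have [c' -> _] := ev_bounded_span (leqnn (msize p)); exists c'.
Qed.

(** The comparison of top components. On the points [j] agrees with a polynomial
    of lower degree, hence with a combination of members of lower degree, which
    cannot cancel the coefficients in degree [d] since the evaluated family is
    free. *)
Lemma top_coeff0 d c q j :
  vanishing k alpha q -> q = \sum_i c i *: b i + j ->
  Jk k j -> (msize j <= d.+1)%N ->
  forall i, msize (b i) = d.+1 -> c i = 0.
Proof.
move=> vq qE Jj jd i bi; have [j' j'd vj] := red Jj jd.
have [c' evj' c'd] := ev_bounded_span j'd.
have cc' : \sum_i (c i + c' i) *: ev (b i) = 0.
  under eq_bigr do rewrite scalerDl; rewrite big_split /= -evj'.
  transitivity (ev q); last exact/ev_eq0; rewrite qE linearD /= ev_comb.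
  by have /ev_eq0/eqP := vj; rewrite linearB subr_eq0 /= => /eqP ->.
have := ev_basis_free cc' i; rewrite c'd ?addr0 // bi; exact: ltnSn.
Qed.

Lemma basis_free c : Jk k (\sum_i c i *: b i) -> forall i, c i = 0.
Proof.
move=> Jc; apply: contrapT => /existsNP[i0 /eqP ci0].
have [i ci imax'] := arg_maxnP (P := fun i => c i != 0) (fun i => msize (b i)) ci0.
have imax j : c j != 0 -> (msize (b j) <= msize (b i))%N by apply: imax'.
case E : (msize (b i)) => [|d].
  move/eqP: ci; apply; apply: (@ev_basis_free c) => //.
  apply: big1 => j _; have [->|cj] := eqVneq (c j) 0; first by rewrite scale0r.
  have := imax j cj; rewrite E leqn0 msize_poly_eq0 => /eqP->.
  by rewrite linear0 scaler0.
move/eqP: ci; apply.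
apply: (top_coeff0 (q := 0) (j := - \sum_i c i *: b i) _ _ _ _ E).
- by move=> w; rewrite meval0.
- by rewrite subrr.
- exact: idealN (Jk_ideal n k) Jc.
- rewrite msizeN; apply: comb_msize => j; rewrite -E ltnNge => /negP bj.
  by apply/eqP; apply: contrapT => /negP/imax.
Qed.

Lemma top_ideal_Jk p : top_ideal (Xnk k alpha) p -> Jk k p.
Proof.
apply: ideal_gen_min; first exact: Jk_ideal.
move=> _ [f [vf f0] <-].
have szf : msize f = (msize f).-1.+1.
  by rewrite prednK // lt0n msize_poly_eq0.
set d := (msize f).-1 in szf.
have [c Jc cd] := bounded_span (leqnn (msize f)).
set j := f - _ in Jc.
have jd : (msize j <= d.+1)%N.
  by rewrite -szf; apply: msizeB_leW => //; apply: comb_msize.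
have c0 i : msize (b i) = d.+1 -> c i = 0.
  apply: (top_coeff0 (q := f) (j := j)) => //; last by rewrite /j addrC subrK.
  by move=> w; apply: vf; exists w.
suff -> : top_component f = pihomog mdeg d j.
  by have [] := Jk_graded_lift kn alpha_inj Jc d.
rewrite /j raddfB /= (@pihomog_small _ d (\sum_i _)) ?subr0 //.
apply: comb_msize => i; rewrite leq_eqVlt => /orP[/eqP/esym/c0 //|].
by rewrite -szf; apply: cd.
Qed.

Lemma Jk_eq_top_ideal : @Jk n k = top_ideal (Xnk k alpha).
Proof.
apply/seteqP; split=> p; [exact: Jk_top_ideal|exact: top_ideal_Jk].
Qed.

(** The normal form sends [p] to the combination of the basis congruent to it;
    uniqueness of the coefficients makes it linear, and makes it compatible with
    the degree bounds of [bounded_span]. *)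
Lemma normal_form_exists : exists nf : {linear {mpoly rat[n]} -> {mpoly rat[n]}},
  [/\ forall p, Jk k (p - nf p), forall p, (msize (nf p) <= msize p)%N &
      forall p, Jk k p -> nf p = 0].
Proof.
have /choice[cf cfP] : forall p, exists c,
    Jk k (p - \sum_i c i *: b i) /\ forall i, (msize p < msize (b i))%N -> c i = 0.
  by move=> p; have [c] := bounded_span (leqnn (msize p)); exists c.
pose nf p := \sum_i cf p i *: b i.
have uniq_nf p c : Jk k (p - \sum_i c i *: b i) -> nf p = \sum_i c i *: b i.
  move=> Jc; apply/eqP; rewrite -subr_eq0 -sumrB; apply/eqP.
  have c0 : forall i, c i - cf p i = 0.
    apply: basis_free; under eq_bigr do rewrite scalerBl.
    rewrite sumrB; have := idealB (Jk_ideal n k) (cfP p).1 Jc.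
    by rewrite opprB addrC addrA subrK.
  apply: big1 => i _; rewrite -scalerBl -opprB c0 oppr0; exact: scale0r.
have nf_lin : linear nf.
  move=> a p q.
  have combE : a *: nf p + nf q = \sum_i (a * cf p i + cf q i) *: b i.
    rewrite scaler_sumr -big_split; apply: eq_bigr => i _.
    by rewrite scalerDl scalerA.
  rewrite combE; apply: uniq_nf; rewrite -combE opprD addrACA -scalerBr.
  apply: (idealD (Jk_ideal n k)); last exact: (cfP q).1.
  exact: idealZ (Jk_ideal n k) (cfP p).1.
pose nf_mx := GRing.isLinear.Build rat _ _ _ nf nf_lin.
pose nfL : {linear {mpoly rat[n]} -> {mpoly rat[n]}} := HB.pack nf nf_mx.
exists nfL; split=> p.
- exact: (cfP p).1.
- exact/comb_msize/(cfP p).2.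
- move=> Jp; have comb0 : \sum_i (0 : rat) *: b i = 0.
    by apply: big1 => i _; rewrite scale0r.
  by rewrite /= (uniq_nf p (fun=> 0)) comb0 // subr0.
Qed.

End HomogeneousBasis.

(** * The equivariant isomorphism *)

Section Symmetrization.
Variables (n k : nat) (kn : (k <= n)%N) (alpha : 'I_n -> rat).
Hypothesis alpha_inj : injective alpha.
Variable nf : {linear {mpoly rat[n]} -> {mpoly rat[n]}}.
Hypothesis nf_Jk : forall p, Jk k (p - nf p).
Hypothesis nf_msize : forall p, (msize (nf p) <= msize p)%N.
Hypothesis nf_Jk0 : forall p, Jk k p -> nf p = 0.
Implicit Types (s t : 'S_n) (p q : {mpoly rat[n]}) (u : QW n k).

Local Notation ev := (@ev n k alpha).

(** The normal form is made equivariant by averaging its conjugates, up to the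
    factor [n!]. Averaging an isomorphism could destroy its bijectivity in
    general; it does not here because every conjugate of [nf] is the identity
    modulo [J_{n,k}]. *)
Definition symev p : QW n k :=
  \sum_(s : 'S_n) QW_act s (ev (nf (msym (s^-1)%g p))).

Lemma symev_is_linear : linear symev.
Proof.
move=> c p q; rewrite /symev scaler_sumr -big_split; apply: eq_bigr => s _.
by rewrite msymD msymZ !linearP.
Qed.

HB.instance Definition _ :=
  GRing.isLinear.Build rat {mpoly rat[n]} (QW n k) _ symev symev_is_linear.

Lemma QW_actM s t u : QW_act (s * t)%g u = QW_act t (QW_act s u).
Proof. by have [p <-] := ev_surj alpha_inj u; rewrite -!ev_msym msymMm. Qed.

Lemma symev_msym t p : symev (msym t p) = QW_act t (symev p).
Proof.
rewrite /symev linear_sum /= (reindex_inj (@mulIg _ t)) /=.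
apply: eq_bigr => s _; rewrite QW_actM -msymMm invMg mulgA mulgV mul1g.
by [].
Qed.

Lemma symev_Jk p : Jk k p -> symev p = 0.
Proof.
move=> Jp; apply: big1 => s _.
by rewrite nf_Jk0 ?linear0 //; apply: msym_Jk.
Qed.

(** The difference between [p] and each conjugate normal form of [p] lies in
    [J_{n,k}], so that [Jk_reduce] applies to it. *)
Lemma ev_symev_reduce d p : (msize p <= d.+1)%N ->
  exists2 p', (msize p' <= d)%N & ev p *+ #|{perm 'I_n}| = symev p + ev p'.
Proof.
move=> pd.
have /choice[q qP] : forall s : 'S_n, exists q, (msize q <= d)%N /\
    ev (msym (s^-1)%g p) = ev (nf (msym (s^-1)%g p)) + ev q.
  move=> s; set ps := msym _ p.
  have psd : (msize ps <= d.+1)%N := leq_trans (msize_msym _ _) pd.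
  have [|q qd vq] := Jk_reduce kn alpha_inj (d := d) (nf_Jk ps).
    by apply: msizeB_leW => //; apply: leq_trans (nf_msize _) psd.
  exists q; split=> //; have /ev_eq0/eqP := vq.
  by rewrite !linearB /= subr_eq0 subr_eq addrC => /eqP.
exists (\sum_s msym s (q s)).
  by apply: msize_sum_le => s _; apply: leq_trans (msize_msym _ _) (qP s).1.
rewrite linear_sum /symev -big_split /= -sumr_const; apply: eq_bigr => s _.
by rewrite ev_msym -linearD /= -(qP s).2 -ev_msym -msymMm mulVg msym1m.
Qed.

(** Induction on the degree by [ev_symev_reduce], dividing by [n!]. *)
Lemma symev_surj u : exists p, symev p = u.
Proof.
have [p <-] := ev_surj alpha_inj u.
have : (msize p <= msize p)%N by [].
move: {2}(msize p) => d; elim: d p => [|d IH] p pd.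
  by move: pd; rewrite leqn0 msize_poly_eq0 => /eqP->; exists 0; rewrite !linear0.
have [p' p'd pE] := ev_symev_reduce pd; have [q qE] := IH p' p'd.
exists ((#|{perm 'I_n}|%:R)^-1 *: (p + q)).
rewrite linearZ linearD /= qE -pE -scaler_nat scalerA mulVf ?scale1r //.
by rewrite Num.Theory.pnatr_eq0 -lt0n; apply/card_gt0P; exists 1%g.
Qed.

End Symmetrization.

Section Quotient.
Variables (n k : nat) (kn : (k <= n)%N).

Lemma Snk_pi_surj (x : Snk kn) : exists p, x = \pi_(Snk kn)%qT p.
Proof. by exists (repr x); rewrite reprK. Qed.

Lemma Snk_piZ c (p : {mpoly rat[n]}) :
  \pi_(Snk kn)%qT (c *: p) = c *: (\pi_(Snk kn)%qT p : Snk kn).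
Proof. by rewrite -mul_mpolyC rmorphM. Qed.

End Quotient.

Theorem theorem4p2 (n k : nat) (k_gt0 : (1 <= k)%N) (kn : (k <= n)%N)
    (alpha : 'I_n -> rat) (alpha_inj : injective alpha) :
  @Jk n k = top_ideal (Xnk k alpha) /\
  exists phi : {linear QW n k -> Snk kn},
    bijective phi /\
    forall (s : 'S_n) (u : QW n k), phi (QW_act s u) = Snk_act s (phi u).
Proof.
have [N [b [hb sb]] leN] := spans_Jk k_gt0 (leqW kn).
split; first exact: (Jk_eq_top_ideal kn alpha_inj hb sb leN).
have [nf [nf_Jk nf_msize nf_Jk0]] := normal_form_exists kn alpha_inj hb sb leN.
pose sy : {linear {mpoly rat[n]} -> QW n k} := @symev n k alpha nf.
have sy_Jk p : sy p = 0 -> Jk k p.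
  move=> p0; have [c Jc] := sb p.
  suff c0 i : c i = 0.
    by move: Jc; rewrite big1 ?subr0 // => i _; rewrite c0 scale0r.
  have sy_comb c' : sy (\sum_i c' i *: b i) = \sum_i c' i *: sy (b i).
    by rewrite linear_sum; apply: eq_bigr => j _; rewrite linearZ.
  have sy_red q c' : Jk k (q - \sum_i c' i *: b i) -> sy q = \sum_i c' i *: sy (b i).
    move/(@symev_Jk n k alpha nf nf_Jk0)/eqP; rewrite -/(sy _) linearB /=.
    by rewrite subr_eq0 => /eqP ->; apply: sy_comb.
  apply: (spanning_free leN (f := sy \o b)); last by rewrite -(sy_red _ _ Jc) p0.
  move=> u; have [q <-] := symev_surj kn alpha_inj nf_Jk nf_msize u.
  by have [c' Jc'] := sb q; exists c'; rewrite -(sy_red _ _ Jc').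
pose psi (x : Snk kn) : QW n k := sy (repr x).
have psi_pi p : psi (\pi_(Snk kn)%qT p) = sy p.
  apply/eqP; rewrite -subr_eq0 -linearB; apply/eqP/symev_Jk => //.
  by apply/Snk_eqP; rewrite reprK.
have psi_lin : linear psi.
  move=> c x y; have [p ->] := Snk_pi_surj x; have [q ->] := Snk_pi_surj y.
  by rewrite -Snk_piZ -rmorphD !psi_pi linearP.
have psi_inj : injective psi.
  move=> x y; have [p ->] := Snk_pi_surj x; have [q ->] := Snk_pi_surj y.
  rewrite !psi_pi => /eqP; rewrite -subr_eq0 -linearB => /eqP/sy_Jk.
  by move/(Snk_eqP kn).
have /choice[phi phiK] : forall u, exists x, psi x = u.
  move=> u; have [p <-] := symev_surj kn alpha_inj nf_Jk nf_msize u.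
  by exists (\pi_(Snk kn)%qT p).
have psiK : cancel psi phi by move=> x; apply: psi_inj; rewrite phiK.
pose psiL : {linear Snk kn -> QW n k} :=
  HB.pack psi (GRing.isLinear.Build rat _ _ _ psi psi_lin).
have phi_lin : linear phi := can2_linear (f := psiL) psiK phiK.
pose phiL : {linear QW n k -> Snk kn} :=
  HB.pack phi (GRing.isLinear.Build rat _ _ _ phi phi_lin).
exists phiL; split; first by exists psi.
move=> s u; apply: psi_inj; rewrite /= phiK.
have [p pE] := Snk_pi_surj (phi u).
rewrite -[in LHS](phiK u) pE Snk_act_pi !psi_pi /=.
by rewrite symev_msym.
Qed.
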